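(* Let $\mathcal{X}$ be one of the following lattices: (1) (arithmetic case) $\mathcal{X} = \mathbb{N}_0 = \{0,1,2,\dots\}$ with $\land = \mathrm{lcm}$ and $\lor = \gcd$; (2) (chain case) $\mathcal{X} = M$ a totally ordered set, with $\land = \min$ and $\lor = \max$; (3) (power set case) $\mathcal{X} = \mathcal{P}(M)$ the power set of a set $M$, with $\land = \cap$ and $\lor = \cup$. Then for all $x,a,y,b,z \in \mathcal{X}$, $$L(x,a,y,b,z) = U(x,a,y,b,z).$$
   Context: For elements $x,a,y,b,z$ of a lattice $(\mathcal{X},\land,\lor)$ put $$L(x,a,y,b,z) := \bigl(b \land (z \lor (a \land y))\bigr) \lor \bigl(z \land (b \lor (x \land y))\bigr) \lor \bigl(x \land (a \lor (z \land y))\bigr) \lor \bigl(a \land (x \lor (b \land y))\bigr),$$ $$U(x,a,y,b,z) := \bigl(a \lor (z \land (b \lor y))\bigr) \land \bigl(x \lor (b \land (z \lor y))\bigr) \land \bigl(z \lor (a \land (x \lor y))\bigr) \land \bigl(b \lor (x \land (a \lor y))\bigr).$$ In $\mathbb{N}_0$ the usual conventions are $\gcd(0,n)=n$ and $\mathrm{lcm}(0,n)=0$ for all $n\in\mathbb{N}_0$. *)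

(* Defs.v *)
From mathcomp Require Import all_boot all_order.
From mathcomp Require Import boolp classical_sets.

Set Implicit Arguments.
Unset Strict Implicit.
Unset Printing Implicit Defensive.

Local Open Scope order_scope.

Definition L (d : Order.disp_t) (X : latticeType d) (x a y b z : X) : X :=
  (b `&` (z `|` (a `&` y))) `|` (z `&` (b `|` (x `&` y)))
  `|` (x `&` (a `|` (z `&` y))) `|` (a `&` (x `|` (b `&` y))).

Definition U (d : Order.disp_t) (X : latticeType d) (x a y b z : X) : X :=
  (a `|` (z `&` (b `|` y))) `&` (x `|` (b `&` (z `|` y)))
  `&` (z `|` (a `&` (x `|` y))) `&` (b `|` (x `&` (a `|` y))).

(* In the library's [natdvd], nat ordered by divisibility, meet is gcd and join
   is lcm; the lattice with meet lcm and join gcd is its dual, whose order is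
   reversed divisibility. *)
Lemma meet_arithE (m n : Order.dual natdvd) : m `&` n = lcmn m n.
Proof. by []. Qed.

Lemma join_arithE (m n : Order.dual natdvd) : m `|` n = gcdn m n.
Proof. by []. Qed.

Lemma meet_chainE (d : Order.disp_t) (M : orderType d) (s t : M) :
  s `&` t = Order.min s t.
Proof. exact: Order.TotalTheory.meetEtotal. Qed.

Lemma join_chainE (d : Order.disp_t) (M : orderType d) (s t : M) :
  s `|` t = Order.max s t.
Proof. exact: Order.TotalTheory.joinEtotal. Qed.

Lemma meet_powersetE (M : Type) (A B : set M) :
  A `&` B = setI A B.
Proof. by []. Qed.

Lemma join_powersetE (M : Type) (A B : set M) :
  A `|` B = setU A B.
Proof. by []. Qed.

(* Main.v *)
Require Import Defs.
From mathcomp Require Import all_boot all_order.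
From mathcomp Require Import boolp classical_sets.

(** All three lattices are distributive, and [distr_LU] settles every distributive lattice. Writing
    meets as products, there [L] expands to the join of xa, bz, aby and xyz; the product of the
    first two factors of [U] expands to the same join, and so does that of the last two. *)

Import Order.LTheory.

(* A meet of atoms is join-prime in a free distributive lattice, so this search
   is complete once the left-hand side is a join of meets of atoms, provided
   that left meets are decomposed last. *)
Ltac le_lattice :=
  lazymatch goal with
  | |- is_true (Order.le (Order.join _ _) _) =>
      rewrite leUx; apply/andP; split; le_lattice
  | |- is_true (Order.le _ (Order.meet _ _)) =>
      rewrite lexI; apply/andP; split; le_lattice
  | |- is_true (Order.le _ (Order.join _ _)) =>
      solve [apply: lexUl; le_lattice | apply: lexUr; le_lattice]
  | |- is_true (Order.le (Order.meet _ _) _) =>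
      solve [apply: leIxl; le_lattice | apply: leIxr; le_lattice]
  | |- _ => exact: lexx
  end.

Lemma distr_LU (d : Order.disp_t) (X : distrLatticeType d) (x a y b z : X) :
  L x a y b z = U x a y b z.
Proof.
apply: le_anti; rewrite /L /U; apply/andP; split.
  by rewrite !meetUr; le_lattice.
(* In [L] joins occur only as right factors of meets; the outer meets of [U] have joins on both
   sides, so [meetUl] is needed to reach a join of meets of atoms. *)
by rewrite !(meetUl, meetUr); le_lattice.
Qed.

Theorem theorem1p1 :
  (forall x a y b z : Order.dual natdvd, L x a y b z = U x a y b z)
  /\ (forall (d : Order.disp_t) (M : orderType d) (x a y b z : M),
        L x a y b z = U x a y b z)
  /\ (forall (M : Type) (x a y b z : set M), L x a y b z = U x a y b z).
Proof. by split; [|split] => *; apply: distr_LU. Qed.
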